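(* There exists a function $f(t,k)$ with the following property. Let $G$ be a graph, $X \subseteq V(G)$, and $k,t \ge 1$ integers. Then either $G$ contains $t$ pairwise edge-disjoint $X$-spiders each of order $k$, or there exists a set $Z$ of at most $f(t,k)$ edges of $G$ such that every $X$-spider of order $k$ in $G$ contains an edge of $Z$.
   Context: Graphs may have parallel edges but no loops. For $X\subseteq V(G)$ and an integer $k\ge1$, an $X$-spider of order $k$ consists of a vertex $v\in V(G)\setminus X$ (its body) together with $k$ pairwise edge-disjoint paths $P_1,\dots,P_k$, each having one endpoint $v$, the other endpoint in $X$, and no internal vertex in $X$. Edge-disjoint spiders may share body vertices. *)

(* Defs.v *)
From mathcomp Require Import all_boot.

Set Implicit Arguments.
Unset Strict Implicit.
Unset Printing Implicit Defensive.

(* Finite loopless multigraph: parallel edges are distinct elements of [edge]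
   with the same set of ends; the ends being exactly two excludes loops. *)
Record mgraph := MGraph {
  vertex : finType;
  edge : finType;
  ends : edge -> {set vertex};
  card_ends : forall e, #|ends e| = 2
}.

Section Spiders.
Variable G : mgraph.
Implicit Types (x : vertex G) (p : seq (edge G * vertex G)).

(* The walk x, e1, x1, ..., en, xn is encoded by its first vertex x and the
   sequence [:: (e1, x1); ...; (en, xn)]. *)
Fixpoint is_walk x p : bool :=
  if p is (e, y) :: p' then (ends e == [set x; y]) && is_walk y p' else true.

Definition is_path x p : bool := is_walk x p && uniq (x :: unzip2 p).

Definition path_end x p : vertex G := last x (unzip2 p).

(* The vertices of the path other than its first and last ones. *)
Definition internal_vertices x p : seq (vertex G) :=
  behead (belast x (unzip2 p)).

Definition path_edges p : {set edge G} := [set e in unzip1 p].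

(* Each leg is oriented from the body to X. *)
Record spider (X : {set vertex G}) (k : nat) := Spider {
  body : vertex G;
  leg : 'I_k -> seq (edge G * vertex G);
  body_notin : body \notin X;
  leg_path : forall i, is_path body (leg i);
  leg_end : forall i, path_end body (leg i) \in X;
  leg_internal : forall i y,
    y \in internal_vertices body (leg i) -> y \notin X;
  leg_disjoint : forall i j, i != j ->
    [disjoint path_edges (leg i) & path_edges (leg j)]
}.

Definition spider_edges (X : {set vertex G}) (k : nat) (s : spider X k) :
    {set edge G} :=
  \bigcup_(i < k) path_edges (leg s i).

End Spiders.

(* Main.v *)
(** By Menger's theorem, t edge-disjoint spiders with bodies s_1, ..., s_t (possibly
    repeated) exist as soon as every set S disjoint from X satisfies
    d(S) >= k * #{i | s_i in S}. Choose bodies greedily under this condition.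
    If the choice gets stuck before t bodies, every body w of a spider lies in a
    minimal violating set S; it has d(S) < k t, it is connected, and, since
    d(S) >= k, it contains an earlier body v. By the important cuts argument, all
    connected sets around v with d(S) <= m are covered by at most 2^(2m+1) sets
    with d <= m, whatever the size of the graph. The boundaries of these covering
    sets, taken over the fewer than t earlier bodies v, form the hitting set. *)

Require Import Defs.
From mathcomp Require Import all_boot zify.

Set Implicit Arguments.
Unset Strict Implicit.
Unset Printing Implicit Defensive.

Lemma disjointsU (T : finType) (A B C : {set T}) :
  [disjoint A & C] -> [disjoint B & C] -> [disjoint A :|: B & C].
Proof. by rewrite !disjoints_subset subUset => -> ->. Qed.

(** * Cuts in digraphs and the covering of important cuts *)

Section Digraph.
Variables (V Arc : finType) (src tgt : Arc -> V).
Implicit Types (A : {set Arc}) (S W X : {set V}) (a : Arc).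

Definition leaves a S : bool := (src a \in S) && (tgt a \notin S).

Definition outdeg A S : nat := \sum_(a in A) leaves a S.

Lemma outdegD1 A S a : a \in A -> outdeg A S = leaves a S + outdeg (A :\ a) S.
Proof. exact: big_setD1. Qed.

Lemma outdeg_submod A S W :
  outdeg A (S :|: W) + outdeg A (S :&: W) <= outdeg A S + outdeg A W.
Proof.
rewrite /outdeg -!big_split /=; apply: leq_sum => a _; rewrite /leaves !inE.
by do !case: (_ \in _).
Qed.

Lemma outdegE A S : outdeg A S = #|[set a in A | leaves a S]|.
Proof.
rewrite /outdeg -sum1dep_card big_mkcondr /=.
by apply: eq_bigr => a _; case: leaves.
Qed.

(* In a symmetric digraph: S is connected once W is contracted. *)
Definition grows_within A W S : Prop :=
  forall B : {set V}, W \subset B -> B \proper S ->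
    exists2 a, a \in A & (src a \in B) && (tgt a \in S :\: B).

(* The branching algorithm for important cuts: if W is the largest minimum cut
   around the core W0 and a an arc leaving W, a cut either contains the head of
   a, so that the minimum cut around the new core is larger, or loses a, so that
   the budget m drops. Both decrease 2m - (minimum cut). *)
Lemma important_cuts_cover n m A W0 X :
  (forall S, W0 \subset S -> [disjoint S & X] -> 2 * m < n + outdeg A S) ->
  exists L : seq {set V}, [/\ size L <= 2 ^ n,
    forall W, W \in L -> [disjoint W & X] /\ outdeg A W <= m &
    forall S, W0 \subset S -> [disjoint S & X] -> outdeg A S <= m ->
      grows_within A W0 S -> exists2 W, W \in L & S \subset W].
Proof.
elim: n m A W0 => [|n IH] m A W0 Hn.
  exists [::]; split=> // S sWS dSX mS _.
  by have := Hn _ sWS dSX; lia.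
pose P S := (W0 \subset S) && [disjoint S & X].
have [S0 /andP[PS0 mS0]|noS] := pickP (fun S => P S && (outdeg A S <= m)); last first.
  exists [::]; split=> // S sWS dSX mS _.
  by have := noS S; rewrite /P sWS dSX mS.
have [W1 PW1 minW1] := arg_minnP (outdeg A) PS0.
have PQ1 : P W1 && (outdeg A W1 == outdeg A W1) by rewrite PW1 eqxx.
have [W /andP[PW /eqP dW] maxW] :=
  arg_maxnP (P := fun S => P S && (outdeg A S == outdeg A W1)) (fun S => #|S|) PQ1.
have {}minW S : P S -> outdeg A W <= outdeg A S by rewrite dW; apply: minW1.
have {}maxW S : P S -> W \proper S -> outdeg A W < outdeg A S.
  move=> PS sWS; rewrite ltn_neqAle minW // andbT; apply/eqP=> eqS.
  have := maxW S; rewrite PS -dW eqS eqxx => /(_ isT).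
  by have := proper_card sWS; lia.
have mW : outdeg A W <= m by apply: leq_trans (minW _ PS0) mS0.
have /andP[W0W dWX] := PW.
(* If no arc leaves [W], then [W] alone covers: growing [S] from [S :&: W] would need an arc that
   leaves [W]. *)
have [a /andP[aA aW]|noa] := pickP (fun a => (a \in A) && leaves a W); last first.
  exists [:: W]; split.
  - by rewrite /= expn_gt0.
  - by move=> S; rewrite inE => /eqP ->.
  move=> S W0S dSX mS growS; exists W; first by rewrite inE.
  apply/negPn/negP => nSW.
  have [||a aA /andP[aS aS']] := growS (S :&: W).
  - by rewrite subsetI W0S.
  - by rewrite properEneq subsetIl andbT; apply: contra nSW => /eqP/setIidPl.
  have := noa a; rewrite aA /leaves; move: aS aS'; rewrite !inE.
  by do !case: (_ \in _).
have [uW wW] := andP aW.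
have nlt : 2 * m < n.+1 + outdeg A W by apply: Hn.
have W1pos : 0 < outdeg A W by rewrite (outdegD1 _ aA) aW.
have [L1 [sz1 H1 C1]] : exists L : seq {set V}, [/\ size L <= 2 ^ n,
    forall W, W \in L -> [disjoint W & X] /\ outdeg A W <= m &
    forall S, tgt a |: W \subset S -> [disjoint S & X] -> outdeg A S <= m ->
      grows_within A (tgt a |: W) S -> exists2 W, W \in L & S \subset W].
  apply: IH => S sS dSX.
  suff : outdeg A W < outdeg A S by clear -nlt; lia.
  apply: maxW.
    by rewrite /P dSX andbT (subset_trans W0W) // (subset_trans _ sS) // subsetUr.
  apply: proper_sub_trans sS; rewrite properE subsetUr /=.
  by apply/subsetPn; exists (tgt a); rewrite ?setU11.
have [L2 [sz2 H2 C2]] : exists L : seq {set V}, [/\ size L <= 2 ^ n,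
    forall S, S \in L -> [disjoint S & X] /\ outdeg (A :\ a) S <= m.-1 &
    forall S, W \subset S -> [disjoint S & X] -> outdeg (A :\ a) S <= m.-1 ->
      grows_within (A :\ a) W S -> exists2 W, W \in L & S \subset W].
  apply: IH => S sS dSX.
  (* Deleting [a] lowers an outdegree by at most one but [2 * m] by two; here [m > 0], since
     [0 < outdeg A W <= m]. *)
  have := minW S; rewrite /P dSX andbT (subset_trans W0W) // => /(_ isT).
  by rewrite (outdegD1 S aA); case: (leaves a S); clear -nlt mW W1pos; lia.
exists (L1 ++ L2); split.
- by rewrite size_cat expnS; clear -sz1 sz2; lia.
- move=> S; rewrite mem_cat => /orP[/H1//|/H2[dSX mS]]; split=> //.
  by rewrite (outdegD1 S aA); case: (leaves a S); clear -mS mW W1pos; lia.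
move=> S W0S dSX mS growS.
have dSWX : [disjoint S :|: W & X] by rewrite disjointsU.
(* [S :&: W] still contains the core, so its outdegree is at least that of [W]; by submodularity [S]
   may be replaced by [S :|: W]. *)
have mSW : outdeg A (S :|: W) <= m.
  have := outdeg_submod A S W.
  have := minW (S :&: W); rewrite /P subsetI W0S W0W /=.
  rewrite (disjointWl _ dSX) ?subsetIl // => /(_ isT).
  by clear -mS; lia.
have growSW (B : {set V}) : W \subset B -> B \proper S :|: W ->
    exists2 a, a \in A & (src a \in B) && (tgt a \in S :\: B).
  move=> WB /properP[BS [y yS yB]].
  have [||b bA /andP[b1 b2]] := growS (S :&: B).
  - by rewrite subsetI W0S (subset_trans W0W).
  - rewrite properE subsetIl /=; apply/subsetPn; exists y.
      by move: yS; rewrite inE => /orP[//|/(subsetP WB)]; rewrite (negPf yB).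
    by rewrite inE (negPf yB) andbF.
  exists b => //; move: b1 b2; rewrite !inE.
  by do !case: (_ \in _).
have SsW : S \subset S :|: W by rewrite subsetUl.
(* If the head of [a] lies in [S], the enlarged core applies; otherwise [a] leaves [S :|: W], and
   deleting it saves one unit of budget. *)
have [wS|wS] := boolP (tgt a \in S).
  have [|//|//||U UL sU] := C1 (S :|: W).
  - by rewrite subUset sub1set inE wS subsetUr.
  - move=> B sB pB; have [|b bA /andP[b1 b2]] := growSW B _ pB.
      by apply: subset_trans sB; rewrite subsetUr.
    exists b => //; rewrite b1 /=; move: b2; rewrite !inE.
    by do !case: (_ \in _).
  by exists U; [rewrite mem_cat UL | apply: subset_trans sU].
have [|//|||U UL sU] := C2 (S :|: W).
- by rewrite subsetUr.
- have := mSW; rewrite (outdegD1 _ aA) /leaves !inE uW orbT negb_or wS wW /=.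
  by clear; lia.
- move=> B sB pB; have [|b bA /andP[b1 b2]] := growSW B _ pB => //.
  move: b2; rewrite !inE => /andP[b2 b3].
  exists b; rewrite !inE.
    by rewrite bA andbT; apply: contraNneq wS => <-.
  by rewrite b1 b2 b3.
by exists U; [rewrite mem_cat UL orbT | apply: subset_trans sU].
Qed.

(** * Menger's theorem with several sources, and orientations *)

Section Menger.
Variables (X : {set V}) (I : finType).
Implicit Type q : I -> V.

Definition demand q S : nat := \sum_i (q i \in S).

Lemma demand_mod q S W :
  demand q (S :|: W) + demand q (S :&: W) = demand q S + demand q W.
Proof.
rewrite /demand -!big_split /=; apply: eq_bigr => i _; rewrite !inE.
by do !case: (_ \in _).
Qed.

Definition cut_condition q A : bool :=
  [forall S : {set V}, [disjoint S & X] ==> (demand q S <= outdeg A S)].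

Lemma cut_conditionP q A : reflect
  (forall S, [disjoint S & X] -> demand q S <= outdeg A S) (cut_condition q A).
Proof.
by apply: (iffP forallP) => H S; [move=> d; apply: (implyP (H S)) | apply/implyP/H].
Qed.

Fixpoint dwalk x (p : seq Arc) : bool :=
  if p is a :: p' then (src a == x) && dwalk (tgt a) p' else true.

(* Move one source along an arc and delete that arc; the only obstacle is a
   tight set entered by the arc, and tight sets are closed under union. *)
Lemma arc_disjoint_walks q A : cut_condition q A ->
  exists p : I -> seq Arc,
    [/\ forall i, dwalk (q i) (p i) /\ last (q i) (map tgt (p i)) \in X,
        forall i a, a \in p i -> (a \in A) && (src a \notin X) &
        forall i j a, i != j -> a \in p i -> a \notin p j].
Proof.
have [n] := ubnP #|A|; elim: n => // n IH in A q *.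
rewrite ltnS => szA /cut_conditionP cA.
have [i0 vX|allX] := pickP (fun i => q i \notin X); last first.
  exists (fun _ => [::]); split=> // i; split=> //=.
  by apply: negbFE; apply: allX.
set v := q i0 in vX.
pose tight S := [&& [disjoint S & X], v \notin S & outdeg A S == demand q S].
have t0 : tight set0.
  rewrite /tight -setI_eq0 set0I eqxx inE /= /outdeg /demand.
  by rewrite !big1 // => ?; rewrite /leaves !inE.
have [S /and3P[dSX vS /eqP tS] maxS] := arg_maxnP (fun S => #|S|) t0.
(* An arc from [v] out of the largest tight set [S] must exist: otherwise adding [v] to [S] raises
   the demand without raising the outdegree. *)
have [a /and3P[aA /eqP av aS]|noa] :=
    pickP (fun a => [&& a \in A, src a == v & tgt a \notin S]); last first.
  have d1 : [disjoint v |: S & X] by rewrite disjointsU ?disjoints1.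
  have: outdeg A (v |: S) <= outdeg A S.
    apply: leq_sum => a aA; have := noa a; rewrite aA /leaves !inE /=.
    by do !case: (_ \in _); do ?case: (_ == _).
  have := cA _ d1; have := demand_mod q [set v] S; rewrite tS.
  have -> : [set v] :&: S = set0.
    by apply/setP=> y; rewrite !inE; case: eqP => // ->; rewrite (negPf vS).
  have -> : demand q set0 = 0 by rewrite /demand big1 // => i _; rewrite inE.
  have : 0 < demand q [set v] by rewrite /demand (bigD1 i0) //= inE eqxx.
  by clear; lia.
pose q' i := if i == i0 then tgt a else q i.
have [||p [pw pA pd]] := IH (A :\ a) q'.
- by have := cardsD1 a A; rewrite aA; lia.
(* A violated [S'] would contain [tgt a], avoid [v] and be tight for [A]; then [S :|: S'] would be a
   larger tight set. *)
- apply/cut_conditionP => S' dS'.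
  have := cA _ dS'; rewrite (outdegD1 _ aA) /leaves av.
  rewrite /demand !(bigD1 i0 (P := xpredT)) //= {1 2}/q' eqxx.
  have -> : \sum_(i | i != i0) (q' i \in S') = \sum_(i | i != i0) (q i \in S').
    by apply: eq_bigr => i /negPf ni; rewrite /q' ni.
  have [|vS'] := boolP (v \in S'); first by clear; case: (_ \in S'); lia.
  have [aS'|] := boolP (tgt a \in S'); last by clear; lia.
  rewrite /= add0n leq_eqVlt => /orP[/eqP tS'|]; last by clear; lia.
  have tS2 : outdeg A S' = demand q S'.
    rewrite (outdegD1 _ aA) /leaves av (negPf vS').
    by rewrite /demand (bigD1 i0) //= -/v (negPf vS') tS'.
  have dSS : [disjoint S :|: S' & X] by rewrite disjointsU.
  have dII : [disjoint S :&: S' & X] by rewrite (disjointWl _ dSX) ?subsetIl.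
  have := maxS (S :|: S'); rewrite /tight dSS !inE negb_or vS vS' /=.
  have -> : outdeg A (S :|: S') == demand q (S :|: S').
    have := outdeg_submod A S S'; have := demand_mod q S S'.
    by have := cA _ dSS; have := cA _ dII; rewrite tS tS2; clear; lia.
  move=> /(_ isT); have : S \proper S :|: S'.
    rewrite properE subsetUl /=; apply/subsetPn; exists (tgt a) => //.
    by rewrite inE aS' orbT.
  by move/proper_card; clear; lia.
exists (fun i => if i == i0 then a :: p i else p i); split.
- move=> i; have := pw i; rewrite /q'; case: eqP => [->|//] [/= -> ->].
  by rewrite av eqxx.
- move=> i b; have H : b \in p i -> (b \in A) && (src b \notin X).
    by move/pA; rewrite !inE => /andP[/andP[_ ->] ->].
  case: eqP => // _; rewrite inE => /orP[/eqP ->|//].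
  by rewrite aA av.
- have nap i : a \notin p i by apply/negP => /pA; rewrite !inE eqxx.
  move=> i j b nij; case: eqP => [ii|_]; case: eqP => [jj|_].
  + by rewrite ii jj eqxx in nij.
  + by rewrite inE => /orP[/eqP->|]; [rewrite nap | apply: pd].
  + move=> bi; rewrite inE negb_or (pd _ _ _ nij bi) andbT.
    by apply: contraTneq bi => ->.
  + exact: pd.
Qed.

(* In a minimal arc set, a and its reverse cannot both be present: uncrossing
   the two sets that become violated would violate the condition already. *)
Lemma cut_condition_oriented (rev : Arc -> Arc) q A :
  (forall a, src (rev a) = tgt a) -> (forall a, tgt (rev a) = src a) ->
  (forall a, rev a != a) ->
  cut_condition q A ->
  exists2 A', cut_condition q A' & forall a, a \in A' -> rev a \notin A'.
Proof.
move=> srev trev nrev cA0.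
have [B cB minB] := arg_minnP (fun A : {set Arc} => #|A|) cA0.
exists B => // a aB; apply/negP => rB.
have D1 b : b \in B -> exists S, [/\ [disjoint S & X], outdeg (B :\ b) S < demand q S,
    leaves b S & demand q S <= outdeg B S].
  move=> bB; have : ~~ cut_condition q (B :\ b).
    by apply/negP=> /minB; have := cardsD1 b B; rewrite bB; lia.
  rewrite negb_forall => /existsP[S]; rewrite negb_imply -ltnNge => /andP[dS lS].
  have cS := elimT (cut_conditionP _ _) cB _ dS; exists S; split=> //.
  by move: cS lS; rewrite (outdegD1 _ bB); clear; case: leaves => //; lia.
have [S [dS lS aS _]] := D1 _ aB; have [W [dW lW bW _]] := D1 _ rB.
have dSS : [disjoint S :|: W & X] by rewrite disjointsU.
have dII : [disjoint S :&: W & X] by rewrite (disjointWl _ dS) ?subsetIl.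
have arB : a \in B :\ rev a by rewrite !inE aB eq_sym nrev.
have raB : rev a \in B :\ a by rewrite !inE rB nrev.
have EB : B :\ a :\ rev a = B :\ rev a :\ a.
  by apply/setP=> y; rewrite !inE; case: (y == a); rewrite ?andbF.
have cU := (elimT (cut_conditionP _ _) cB) _ dSS.
have cI := (elimT (cut_conditionP _ _) cB) _ dII.
have := outdeg_submod (B :\ a :\ rev a) S W.
have := demand_mod q S W; move: lS lW cU cI.
(* Both ends of [a] lie in [S :|: W] and neither lies in [S :&: W], so deleting [a] and [rev a]
   leaves these two outdegrees unchanged. *)
rewrite (outdegD1 S raB) (outdegD1 W arB) -EB.
rewrite !(outdegD1 _ aB) !(outdegD1 _ raB).
rewrite /leaves srev trev !inE.
have /andP[-> /negPf ->] := aS; have := bW; rewrite /leaves srev trev.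
by case/andP=> [-> /negPf ->] /=; clear; lia.
Qed.

End Menger.
End Digraph.
Lemma card_bigcup_seq (T : finType) (J : eqType) (r : seq J) (F : J -> {set T}) m :
  (forall i, i \in r -> #|F i| <= m) -> #|\bigcup_(i <- r) F i| <= size r * m.
Proof.
elim: r => [|i r IH] H; first by rewrite big_nil cards0.
rewrite big_cons mulSn (leq_trans (leq_card_setU _ _)) // leq_add ?H ?mem_head //.
by apply: IH => j jr; rewrite H // inE jr orbT.
Qed.

(** * Walks in a multigraph and its symmetric digraph *)

Section Walks.
Variable G : mgraph.
Implicit Types (x y : vertex G) (p : seq (edge G * vertex G)).

Lemma is_walk_cat x p1 p2 :
  is_walk x (p1 ++ p2) = is_walk x p1 && is_walk (path_end x p1) p2.
Proof. by elim: p1 x => [|[e y] p1 IH] x //=; rewrite IH andbA. Qed.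

(** Shorten the tail first; if it revisits [x], restart from that visit. The clause on [belast]
    later keeps the internal vertices of legs out of [X]. *)
Lemma walk_shorten x p : is_walk x p ->
  exists p', [/\ is_path x p', path_end x p' = path_end x p,
    {subset unzip1 p' <= unzip1 p} &
    {subset belast x (unzip2 p') <= belast x (unzip2 p)}].
Proof.
elim: p x => [|[e y] p IH] x /=; first by exists [::].
case/andP=> exy /IH[p' [/andP[wp' up'] ep' sp' bp']].
have [xp'|nxp'] := boolP (x \in y :: unzip2 p'); last first.
  exists ((e, y) :: p'); split=> //.
  - by rewrite /is_path /= exy wp' nxp'.
  - by move=> f; rewrite /= !inE => /orP[->//|/sp' ->]; rewrite orbT.
  - by move=> z; rewrite /= !inE => /orP[->//|/bp' ->]; rewrite orbT.
case: (eqVneq x y) xp' => [-> _|nxy].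
  exists p'; split=> //; first by rewrite /is_path wp'.
    by move=> f /sp' fp; rewrite inE fp orbT.
  by move=> z /bp' zp; rewrite inE zp orbT.
rewrite inE (negPf nxy) /= => /mapP[[f z] fp' /= xz]; rewrite -{}xz in fp'.
case/splitPr: fp' => p1 p2 in wp' up' ep' sp' bp' *.
have lcat : unzip2 (p1 ++ (f, x) :: p2) = unzip2 p1 ++ x :: unzip2 p2.
  by rewrite /unzip2 map_cat.
exists p2; split.
- move: wp' up'; rewrite is_walk_cat lcat /is_path /= => /and3P[_ _ ->].
  by rewrite cat_uniq /= => /and5P[_ _ _ -> ->].
- by move: ep'; rewrite /path_end lcat last_cat.
- move=> g gp; rewrite inE sp' ?orbT // /unzip1 map_cat mem_cat.
  by rewrite inE gp !orbT.
- move=> g gp; rewrite inE bp' ?orbT // lcat belast_cat mem_cat /=.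
  by rewrite inE gp !orbT.
Qed.

(** Every edge yields two opposite arcs, one for each ordering of its ends. *)
Definition arc :=
  {a : edge G * (vertex G * vertex G) | ends a.1 == [set a.2.1; a.2.2]}.

Definition arc_edge (a : arc) : edge G := (val a).1.
Definition arc_src (a : arc) : vertex G := (val a).2.1.
Definition arc_tgt (a : arc) : vertex G := (val a).2.2.

Lemma arc_rev_subproof (a : arc) :
  ends (arc_edge a) == [set arc_tgt a; arc_src a].
Proof. by rewrite setUC; apply: (valP a). Qed.

Definition arc_rev (a : arc) : arc :=
  Sub (arc_edge a, (arc_tgt a, arc_src a)) (arc_rev_subproof a).

Lemma ends_arc a : ends (arc_edge a) = [set arc_src a; arc_tgt a].
Proof. exact/eqP/(valP a). Qed.

Lemma arc_src_tgt a : arc_src a != arc_tgt a.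
Proof. by have := card_ends (arc_edge a); rewrite ends_arc cards2; case: eqP. Qed.

Lemma arc_rev_neq a : arc_rev a != a.
Proof.
by apply: contraNneq (arc_src_tgt a) => /(congr1 arc_src) /= <-.
Qed.

Lemma arc_edge_inj a b : arc_edge a = arc_edge b -> b = a \/ b = arc_rev a.
Proof.
move=> eab; have := ends_arc a; rewrite eab ends_arc => /setP eS.
have := eS (arc_src b); have := eS (arc_tgt b); rewrite !inE !eqxx orbT /=.
have := arc_src_tgt b.
case: a b eab {eS} => [[e [x y]] ea] [[e' [x' y']] eb].
rewrite /arc_edge /arc_src /arc_tgt /= => eab; rewrite -{}eab in eb *.
move=> nxy /esym/orP[] /eqP e1 /esym/orP[] /eqP e2; subst => //.
- by rewrite eqxx in nxy.
- by right; apply: val_inj.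
- by left; apply: val_inj.
- by rewrite eqxx in nxy.
Qed.

Notation leavesG := (leaves arc_src arc_tgt).
(** An edge with exactly one end in [S] has exactly one orientation leaving [S], so this is the
    undirected cut size d(S). *)
Notation cutsize := (outdeg arc_src arc_tgt [set: arc]).

Lemma walk_leaves (S : {set vertex G}) x p :
  is_walk x p -> x \in S -> path_end x p \notin S ->
  exists2 a, arc_edge a \in path_edges p & leavesG a S.
Proof.
rewrite /path_edges /path_end.
elim: p x => [|[e y] p IH] x /=; first by move=> _ ->.
case/andP=> exy wp xS; have [yS|yS _] := boolP (y \in S).
  by case/(IH _ wp yS) => a; rewrite !inE => ap aS; exists a; rewrite // !inE ap orbT.
by exists (Sub (e, (x, y)) exy); rewrite ?inE ?eqxx // /leaves /= xS.
Qed.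

Lemma dwalk_walk x (p : seq arc) : dwalk arc_src arc_tgt x p ->
  is_walk x [seq (arc_edge a, arc_tgt a) | a <- p] /\
  belast x (map arc_tgt p) = map arc_src p.
Proof.
elim: p x => [|a p IH] x //= /andP[/eqP <- /IH[wp ->]]; split=> //.
by rewrite ends_arc eqxx.
Qed.

(** * Greedy choice of bodies and the hitting set *)

Section Packing.
Variables (X : {set vertex G}) (k : nat).
Implicit Types (S W : {set vertex G}) (w : vertex G) (s : seq (vertex G)).

(* By Menger's theorem, these are exactly the bodies of spiders of order k. *)
Definition spider_body w : bool :=
  (w \notin X) &&
  [forall S : {set vertex G}, [disjoint S & X] && (w \in S) ==> (k <= cutsize S)].

(** Each leg must leave [S] to reach [X]; as legs are edge-disjoint, the [k] arcs on which they
    leave are distinct. *)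
Lemma body_spider_body (s : spider X k) : spider_body (body s).
Proof.
rewrite /spider_body body_notin; apply/forallP => S; apply/implyP => /andP[dSX bS].
have /fin_all_exists[g gP] i : exists a,
    arc_edge a \in path_edges (leg s i) /\ leavesG a S.
  have [||a] := walk_leaves (S := S) (p := leg s i) _ bS.
  - by have /andP[] := leg_path s i.
  - by rewrite (disjointFl dSX) // leg_end.
  by exists a.
have ginj : injective g.
  move=> i j gij; apply/eqP; apply: contraT => nij.
  have := leg_disjoint s nij.
  by move/disjointFr => /(_ _ (proj1 (gP i))); rewrite gij (proj1 (gP j)).
rewrite outdegE -[k in k <= _]card_ord -(card_codom ginj).
by apply/subset_leq_card/subsetP => a /codomP[i ->]; rewrite !inE; have [] := gP i.
Qed.

Definition mult s S : nat := \sum_(x <- s) (x \in S).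

(** The condition of Menger's theorem when each entry of [s], counted with repetitions, is the
    source of [k] walks to [X]. *)
Definition linkable s : bool :=
  [forall S : {set vertex G}, [disjoint S & X] ==> (k * mult s S <= cutsize S)].

Lemma linkable_spiders t (s : t.-tuple (vertex G)) :
  {in s, forall w, w \notin X} -> linkable s ->
  exists S : 'I_t -> spider X k, forall i j : 'I_t, i != j ->
    [disjoint spider_edges (S i) & spider_edges (S j)].
Proof.
move=> sX /forallP ls.
pose q (ij : 'I_t * 'I_k) := tnth s ij.1.
have cq : cut_condition arc_src arc_tgt X q [set: arc].
  apply/cut_conditionP => S dSX; have := ls S; rewrite dSX /= => /(leq_trans _)-> //.
  rewrite /demand -(pair_bigA _ (fun i j => nat_of_bool (tnth s i \in S))) /=.
  rewrite /mult big_tuple big_distrr /=; apply: leq_sum => i _.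
  by rewrite sum_nat_const card_ord.
(* Arc-disjoint walks could still use an edge in both directions; keeping at most one orientation of
   each edge makes them edge-disjoint. *)
have [|||A cA Aor] // := cut_condition_oriented (rev := arc_rev) _ _ _ cq.
  exact: arc_rev_neq.
have [p [pw pA pd]] := arc_disjoint_walks cA.
have /fin_all_exists[l lP] ij : exists l,
    [/\ is_path (q ij) l, path_end (q ij) l \in X,
        forall y, y \in internal_vertices (q ij) l -> y \notin X &
        {subset unzip1 l <= map arc_edge (p ij)}].
  have [dw eX] := pw ij.
  have [ww bw] := dwalk_walk dw.
  have [p' [pp' ep' sp' bp']] := walk_shorten ww.
  have u1 : unzip1 [seq (arc_edge a, arc_tgt a) | a <- p ij] = map arc_edge (p ij).
    by rewrite /unzip1 -map_comp.
  have u2 : unzip2 [seq (arc_edge a, arc_tgt a) | a <- p ij] = map arc_tgt (p ij).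
    by rewrite /unzip2 -map_comp.
  exists p'; split=> //; last by rewrite -u1.
    by rewrite ep' /path_end u2.
  move=> y /mem_behead /bp'; rewrite u2 bw => /mapP[a /pA /andP[_ aX] ->].
  exact: aX.
have ld ij ij' : ij != ij' -> [disjoint path_edges (l ij) & path_edges (l ij')].
  move=> nij; rewrite disjoint_subset; apply/subsetP => e; rewrite !inE.
  have [_ _ _ s1] := lP ij; have [_ _ _ s2] := lP ij'.
  move=> /s1 /mapP[a ap ->]; apply/negP => /s2 /mapP[b bp eab].
  have /andP[aA _] := pA _ _ ap; have /andP[bA _] := pA _ _ bp.
  case: (arc_edge_inj eab) => bE; rewrite {}bE in bp bA.
    by have := pd _ _ _ nij ap; rewrite bp.
  by have := Aor _ aA; rewrite bA.
have bX i : tnth s i \notin X by rewrite sX // mem_tnth.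
have /fin_all_exists[Sp SpE] i : exists sp : spider X k,
    spider_edges sp = \bigcup_(j < k) path_edges (l (i, j)).
  have lp j : is_path (tnth s i) (l (i, j)) by have [] := lP (i, j).
  have le j : path_end (tnth s i) (l (i, j)) \in X by have [] := lP (i, j).
  have li j y : y \in internal_vertices (tnth s i) (l (i, j)) -> y \notin X.
    by have [_ _ h _] := lP (i, j); apply: h.
  have lld j j' : j != j' ->
      [disjoint path_edges (l (i, j)) & path_edges (l (i, j'))].
    by move=> nj; apply: ld; apply: contra nj => /eqP[->].
  by exists (Spider (bX i) lp le li lld).
exists Sp => i j nij; rewrite !SpE.
apply/pred0P => e /=; apply/negP => /andP[/bigcupP[i' _ ei] /bigcupP[j' _ ej]].
have /disjointFr/(_ ei) : [disjoint path_edges (l (i, i')) & path_edges (l (j, j'))].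
  by apply: ld; apply: contra nij => /eqP[->].
by rewrite /= ej.
Qed.

(** Arcs come in opposite pairs, so no arc joins [W] and [S :\: W] in either direction, and an arc
    leaving one of them leaves [S]. *)
Lemma cutsize_split S W : W \subset S ->
  (forall a, (arc_src a \in W) && (arc_tgt a \in S :\: W) = false) ->
  cutsize W + cutsize (S :\: W) <= cutsize S.
Proof.
move=> sWS noa; rewrite /outdeg -big_split /=; apply: leq_sum => a _.
have := noa a; have := noa (arc_rev a).
have := subsetP sWS (arc_src a); have := subsetP sWS (arc_tgt a).
rewrite /leaves /arc_src /arc_tgt /= !inE.
case: ((val a).2.1 \in W); case: ((val a).2.2 \in W);
case: ((val a).2.1 \in S); case: ((val a).2.2 \in S) => //= h1 h2;
by [move: (h1 isT) | move: (h2 isT)].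
Qed.

(* A minimal violator of the cut condition is connected. *)
Lemma linkable_stuck s w : linkable s -> spider_body w -> ~~ linkable (w :: s) ->
  exists v S, [/\ v \in s, v \in S, w \in S, [disjoint S & X] &
    cutsize S < k * (size s).+1 /\ grows_within arc_src arc_tgt [set: arc] [set v] S].
Proof.
move=> ls /andP[wX /forallP gw]; rewrite negb_forall => /existsP[S0].
rewrite negb_imply -ltnNge => PS0.
have [S /andP[dSX vS] minS] := arg_minnP
  (P := fun S => [disjoint S & X] && (cutsize S < k * mult (w :: s) S))
  (fun S => #|S|) PS0.
have lsS : k * mult s S <= cutsize S by have := forallP ls S; rewrite dSX.
have wS : w \in S.
  by apply: contraTT vS => nwS; rewrite /mult big_cons (negPf nwS) -leqNgt.
have kS : k <= cutsize S by have := gw S; rewrite dSX wS.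
move: (vS); rewrite /mult big_cons wS -/(mult s S) => vS'.
have /hasP[v vs vinS] : has [in S] s.
  apply: contraTT vS' => /hasPn nS; rewrite -leqNgt.
  by rewrite /mult big_seq big1 ?addn0 ?muln1 // => x /nS /negPf ->.
exists v, S; split=> //; split.
  apply: leq_trans vS' _; rewrite leq_mul2l add1n ltnS; apply/orP; right.
  rewrite /mult -sum1_size; apply: leq_sum => x _; exact: leq_b1.
move=> B; rewrite sub1set => vB /properP[sBS [y yS yB]].
have [a /andP[a1 a2]|noa] :=
  pickP (fun a => (arc_src a \in B) && (arc_tgt a \in S :\: B)).
  by exists a; rewrite ?a1.
have cB := cutsize_split sBS noa.
have dB : [disjoint B & X] by rewrite (disjointWl sBS).
have dC : [disjoint S :\: B & X] by rewrite (disjointWl _ dSX) ?subsetDl.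
have mB : mult (w :: s) B + mult (w :: s) (S :\: B) = mult (w :: s) S.
  rewrite /mult -big_split /=; apply: eq_bigr => x _; rewrite inE.
  by have := subsetP sBS x; do 2!case: (x \in _) => // /(_ isT).
have pB : #|B| < #|S|.
  by apply/proper_card/properP; split=> //; exists y.
have pC : #|S :\: B| < #|S|.
  by apply/proper_card/properP; split; rewrite ?subsetDl //; exists v; rewrite ?inE ?vB.
(* By minimality of [S], both [B] and [S :\: B] satisfy the bound; adding the two bounds gives it
   for [S], a contradiction. *)
have nviol W : [disjoint W & X] -> #|W| < #|S| -> k * mult (w :: s) W <= cutsize W.
  move=> dW ltW; rewrite leqNgt; apply/negP => vW.
  by have := minS W; rewrite dW vW leqNgt ltW => /(_ isT).
have := leq_trans (leq_add (nviol _ dB pB) (nviol _ dC pC)) cB.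
by rewrite -mulnDr mB leqNgt vS.
Qed.

(** A body lies in some covering set [W] disjoint from [X], so any single leg of its spider crosses
    the boundary of [W]. *)
Lemma stuck_hitting_set s t : 0 < k -> linkable s -> size s < t ->
  (forall w, spider_body w -> ~~ linkable (w :: s)) ->
  exists Z : {set edge G}, #|Z| <= t * (2 ^ (2 * (k * t)).+1 * (k * t)) /\
    forall sp : spider X k, exists e, e \in spider_edges sp /\ e \in Z.
Proof.
move=> k_gt0 ls szs stuck; set m := k * t.
have /fin_all_exists[L LP] v : exists L : seq {set vertex G},
  [/\ size L <= 2 ^ (2 * m).+1,
    forall W, W \in L -> [disjoint W & X] /\ cutsize W <= m &
    forall S, [set v] \subset S -> [disjoint S & X] -> cutsize S <= m ->
      grows_within arc_src arc_tgt [set: arc] [set v] S ->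
      exists2 W, W \in L & S \subset W].
  (* With [n] equal to [(2 * m).+1] the hypothesis on outdegrees is trivially true. *)
  apply: important_cuts_cover => S _ _.
  by rewrite ltnS leq_addr.
pose bd W := [set arc_edge a | a in [set a in [set: arc] | leavesG a W]].
exists (\bigcup_(v <- s) \bigcup_(W <- L v) bd W); split.
  apply: leq_trans (_ : size s * (2 ^ (2 * m).+1 * m) <= _); last first.
    by rewrite leq_mul2r ltnW ?orbT.
  apply: card_bigcup_seq => v _; have [szL HL _] := LP v.
  apply: leq_trans (_ : size (L v) * m <= _); last by rewrite leq_mul2r szL orbT.
  apply: card_bigcup_seq => W /HL[_]; apply: leq_trans.
  by rewrite outdegE leq_imset_card.
move=> sp; have gw := body_spider_body sp.
have [v [S [vs vS wS dSX [cS growS]]]] := linkable_stuck ls gw (stuck _ gw).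
have [_ HL CL] := LP v.
have [|//|||W WL SW] := CL S; rewrite ?sub1set //.
  by apply: leq_trans (ltnW cS) _; rewrite leq_mul2l szs orbT.
have [dWX _] := HL _ WL; pose i0 := Ordinal k_gt0.
have [||a ap aW] := walk_leaves (S := W) (p := leg sp i0) _ (subsetP SW _ wS).
- by have /andP[] := leg_path sp i0.
- by rewrite (disjointFl dWX) // leg_end.
exists (arc_edge a); split; first by apply/bigcupP; exists i0.
rewrite (big_rem v vs) /= inE (big_rem W WL) /= inE; apply/orP; left.
by apply/orP; left; apply: imset_f; rewrite !inE.
Qed.

(** Induction on the number [n] of bodies chosen greedily; as soon as no further body fits, the
    hitting set exists. *)
Lemma linkable_or_hitting_set t n : 0 < k -> n <= t ->
  (exists2 s : n.-tuple (vertex G), {in s, forall w, w \notin X} & linkable s) \/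
  exists Z : {set edge G}, #|Z| <= t * (2 ^ (2 * (k * t)).+1 * (k * t)) /\
    forall sp : spider X k, exists e, e \in spider_edges sp /\ e \in Z.
Proof.
move=> k_gt0; elim: n => [_|n IH ltnt].
  left; exists [tuple] => //; apply/forallP => S; apply/implyP => _.
  by rewrite /mult big_nil muln0.
have [[s sX ls]|] := IH (ltnW ltnt); last by right.
have [w /andP[gw lws]|now] := pickP (fun w => spider_body w && linkable (w :: s)).
  left; exists [tuple of w :: s] => // x; rewrite inE => /orP[/eqP ->|/sX //].
  by case/andP: gw.
right; apply: (stuck_hitting_set k_gt0 ls); first by rewrite size_tuple.
by move=> w gw; have := now w; rewrite gw => /negbT.
Qed.

End Packing.
End Walks.

Theorem theorem3 :
  exists f : nat -> nat -> nat,
    forall (G : mgraph) (X : {set vertex G}) (k t : nat),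
      1 <= k -> 1 <= t ->
      (exists S : 'I_t -> spider X k,
         forall i j : 'I_t, i != j ->
           [disjoint spider_edges (S i) & spider_edges (S j)])
      \/
      (exists Z : {set edge G},
         #|Z| <= f t k /\
         forall s : spider X k, exists e : edge G, e \in spider_edges s /\ e \in Z).
Proof.
exists (fun t k => t * (2 ^ (2 * (k * t)).+1 * (k * t))) => G X k t k_gt0 _.
have [[s sX ls]|] := linkable_or_hitting_set X k_gt0 (leqnn t); last by right.
by left; apply: linkable_spiders sX ls.
Qed.
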